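(* Let $(G,\sigma)$ be a signed bipartite graph and let $\frac{p}{q}$ be a rational number in $[2,4]$, where $p$ is a positive even integer, $q$ is a positive integer and, subject to $p$ being even, $\frac{p}{q}$ is in its simplest form. Then $$\chi_c(G,\sigma)\leq \frac{p}{q}\quad\text{if and only if}\quad (G,\sigma)\to B_{p;q}.$$
   Context: A signed graph $(G,\sigma)$ is a graph $G$ together with an assignment $\sigma: E(G)\to\{+,-\}$. Two parallel edges between the same two vertices are allowed only if they have different signs. Graphs have no loops unless specified. A signed graph is bipartite if its underlying graph is. For a real number $r\ge 1$ let $C^r$ be a circle of circumference $r$, $d_{C^r}(x,y)$ the length of the shorter arc between $x$ and $y$, and $\overline{x}$ the antipodal point of $x$ (the point at distance $\frac r2$ from $x$). A circular $r$-coloring of $(G,\sigma)$ is a map $\varphi:V(G)\to C^r$ such that $d_{C^r}(\varphi(u),\varphi(v))\ge 1$ for each positive edge $uv$ and $d_{C^r}(\varphi(u),\overline{\varphi(v)})\ge 1$ for each negative edge $uv$. The circular chromatic number is $\chi_c(G,\sigma)=\inf\{r\ge 1: (G,\sigma)\text{ admits a circular } r\text{-coloring}\}$. ''Subject to $p$ being even, $\frac pq$ is in its simplest form'' means that $p$ is the smallest positive even numerator among all representations of the given rational number as a quotient of two positive integers (e.g. $3$ is written $\frac{6}{2}$). $B_{p;q}$ is the signed bipartite graph with vertex set $\{0,1,\dots,p-1\}$ and parts $X=\{0,2,\dots,p-2\}$, $Y=\{1,3,\dots,p-1\}$, where for $i\in X$, $j\in Y$: there is a positive edge $ij$ if and only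 if $q\le |i-j|\le p-q$, and there is a negative edge $ij$ if and only if $|i-j|\le \frac p2-q$ or $|i-j|\ge \frac p2+q$. $(G,\sigma)\to(H,\pi)$ denotes the existence of a (switching) homomorphism: a mapping of $V(G)$ to $V(H)$ and of $E(G)$ to $E(H)$ preserving adjacencies, incidences and the signs of closed walks (the sign of a closed walk is the product of the signs of its edges). Equivalently: after switching $\sigma$ at some set of vertices (switching at a vertex reverses the signs of all edges incident to it) there is a homomorphism of the underlying graphs preserving the signs of edges. *)

(* Defs.v *)
From mathcomp Require Import all_boot all_order all_algebra.
From mathcomp Require Import all_classical all_reals all_analysis.

Set Implicit Arguments.
Unset Strict Implicit.
Unset Printing Implicit Defensive.

Import Order.TTheory GRing.Theory Num.Theory.

Local Open Scope ring_scope.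
Local Open Scope classical_set_scope.

(* [false] is the positive sign and [true] the negative one, so that the
   product of signs is [addb]. *)
Definition sign := bool.
Definition positive : sign := false.
Definition negative : sign := true.

(* An edge is determined by its sign and its two endpoints: parallel edges
   are possible only with different signs.  The vertex set may be infinite. *)
Record sgraph (V : Type) := SGraph {
  sedge : sign -> rel V;
  sedge_sym : forall s, symmetric (sedge s);
  sedge_irr : forall s, irreflexive (sedge s) }.

Definition sbipartite (V : Type) (G : sgraph V) : Prop :=
  exists X : pred V, forall s u v, sedge G s u v -> X u != X v.

Section CircularColoring.
Variable R : realType.

(* The points of the circle of circumference r are the reals x with
   0 <= x < r. *)
Definition circle (r : R) : set R := [set x | 0 <= x < r].

Definition circle_dist (r x y : R) : R := Num.min `|x - y| (r - `|x - y|).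

Definition antipode (r x : R) : R :=
  if x < r / 2 then x + r / 2 else x - r / 2.

Definition circular_coloring (V : Type) (G : sgraph V) (r : R) (phi : V -> R)
    : Prop :=
  [/\ forall v, circle r (phi v),
      forall u v, sedge G positive u v -> 1 <= circle_dist r (phi u) (phi v)
    & forall u v, sedge G negative u v ->
        1 <= circle_dist r (phi u) (antipode r (phi v))].

(* Extended-real valued, so that it is +oo when there is no circular
   r-coloring for any r. *)
Definition circular_chromatic_number (V : Type) (G : sgraph V) : \bar R :=
  ereal_inf [set r%:E | r in
    [set r : R | 1 <= r /\ exists phi : V -> R, circular_coloring G r phi]].

End CircularColoring.

(* A walk from u is the list of its steps, a step (s, v) being the traversal,
   towards v, of the edge of sign s between the current vertex and v. *)
Fixpoint is_walk (V : Type) (G : sgraph V) (u : V) (w : seq (sign * V)) : bool :=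
  if w is (s, v) :: w' then sedge G s u v && is_walk G v w' else true.

Definition is_closed_walk (V : Type) (G : sgraph V) (u : V)
    (w : seq (sign * V)) : Prop :=
  is_walk G u w /\ last u (map snd w) = u.

Definition walk_sign (T : Type) (w : seq (sign * T)) : sign :=
  \big[addb/positive]_(e <- w) e.1.

(* The edge map is encoded by g: the edge uv of sign s is mapped to the edge
   of sign g s u v between f u and f v. *)
Fixpoint map_walk (V W : Type) (f : V -> W) (g : sign -> V -> V -> sign)
    (u : V) (w : seq (sign * V)) : seq (sign * W) :=
  if w is (s, v) :: w' then (g s u v, f v) :: map_walk f g v w' else [::].

(* The first condition makes the edge map well defined on unoriented edges. *)
Definition is_switching_hom (V W : Type) (G : sgraph V) (H : sgraph W)
    (f : V -> W) (g : sign -> V -> V -> sign) : Prop :=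
  [/\ forall s u v, sedge G s u v -> g s u v = g s v u,
      forall s u v, sedge G s u v -> sedge H (g s u v) (f u) (f v)
    & forall u w, is_closed_walk G u w ->
        walk_sign (map_walk f g u w) = walk_sign w].

Definition switching_hom (V W : Type) (G : sgraph V) (H : sgraph W) : Prop :=
  exists (f : V -> W) (g : sign -> V -> V -> sign), is_switching_hom G H f g.

Definition even_simplest_form (p q : nat) : Prop :=
  [/\ (0 < p)%N, (0 < q)%N, ~~ odd p
    & forall p' q' : nat, (0 < p')%N -> (0 < q')%N -> ~~ odd p' ->
        p'%:R / q'%:R = p%:R / q%:R :> rat -> (p <= p')%N].

(* Truncated subtraction is harmless: distinct parity gives 0 < `|i - j| < p,
   so a bound that would be negative excludes the edge, as it should. *)
Definition Bpq_edge (p q : nat) (s : sign) : rel 'I_p := fun i j =>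
  (odd i != odd j) &&
  (let d := `|(i : nat) - (j : nat)|%N in
   if s == positive then (q <= d <= p - q)%N
   else (d <= p./2 - q)%N || (p./2 + q <= d)%N).

Lemma Bpq_sym (p q : nat) (s : sign) : symmetric (@Bpq_edge p q s).
Proof. by move=> i j; rewrite /Bpq_edge distnC eq_sym. Qed.

Lemma Bpq_irr (p q : nat) (s : sign) : irreflexive (@Bpq_edge p q s).
Proof. by move=> i; rewrite /Bpq_edge eqxx. Qed.

Definition Bpq (p q : nat) : sgraph 'I_p :=
  SGraph (@Bpq_sym p q) (@Bpq_irr p q).

(* Main.v *)
Require Import Defs.
From mathcomp Require Import all_boot all_order all_algebra.
From mathcomp Require Import all_classical all_reals all_analysis.
From mathcomp Require Import zify ring lra.

Import Order.TTheory GRing.Theory Num.Theory numFieldNormedType.Exports.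

(** Why the theorem holds.  Instead of measuring distances on the circle, lift
    everything to the line.  A point of the circle of circumference [2 * h] is
    a real modulo [2 * h], the antipodal map is translation by [h], and the
    constraint of an edge of sign [s] reads: the difference of the two colors
    stays at distance at least [q] from every multiple [k * h] of the half
    period with [k] odd for a negative edge and even for a positive one.  This
    is [apart h q s].  In this form, moving the color of a vertex to its
    antipode is the same as switching at that vertex ([apart_shift]), rescaling
    the circle is rescaling the line ([apart_scale]), and B_(p;q) is exactly
    the graph on the integers modulo [p], with opposite parities on the ends
    of an edge, whose [s]-edges are given by [apart p/2 q s] ([Bpq_edgeP]).
    On the graph side, [switching_homP] replaces the closed-walk definition of
    a homomorphism by a vertex map together with a set of switched vertices.

    From a homomorphism to a coloring: give each vertex its image in B_(p;q),
    translated by [p/2] if the vertex is switched, and divide by [q].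

    From the chromatic number to a homomorphism: the infimum is attained, also
    for infinite graphs, because colorings on circles whose circumferences
    approach the infimum converge along an ultrafilter
    ([circular_chromatic_number_attained]).  Scale the circumference to [p];
    the constraint then involves only the integers [p/2] and [q], so it
    survives rounding.  The rounding has to put the two sides of the
    bipartition on opposite parities ([parity_rounding]).  If [p/2] is odd, take
    integer parts and switch the vertices that land on the wrong parity, since
    the antipode has the other parity.  If [p/2] is even, then [q] is odd since
    [p] is the least even numerator ([even_simplest_form_parity]); round one
    side down to even integers and the other side down to odd integers.  These
    two roundings are exchanged by odd translations, and all the translations
    [k * (p/2) - q] and [k * (p/2) + q] that bound the constraint are odd. *)

Local Open Scope ring_scope.

(** * Homomorphisms of signed graphs and switching *)

Section SwitchingHom.
Variables (V W : Type) (G : sgraph V) (H : sgraph W).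

Lemma is_walk_cat (u : V) w1 w2 :
  is_walk G u (w1 ++ w2) =
  is_walk G u w1 && is_walk G (last u (map snd w1)) w2.
Proof. by elim: w1 u => [|[s v] w1 IH] u //=; rewrite IH andbA. Qed.

Lemma walk_sign_cons (T : Type) (e : sign * T) w :
  walk_sign (e :: w) = e.1 (+) walk_sign w.
Proof. by rewrite /walk_sign big_cons. Qed.

Lemma walk_sign_cat (T : Type) (w1 w2 : seq (sign * T)) :
  walk_sign (w1 ++ w2) = walk_sign w1 (+) walk_sign w2.
Proof. by rewrite /walk_sign big_cat. Qed.

Section WalkDefect.
Variables (f : V -> W) (g : sign -> V -> V -> sign).

(** Sign preservation means that the defect vanishes on closed walks; the defect
    is then a potential difference, and the potential is the switching set. *)
Definition walk_defect (u : V) (w : seq (sign * V)) : sign :=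
  walk_sign (map_walk f g u w) (+) walk_sign w.

Lemma map_walk_cat u w1 w2 :
  map_walk f g u (w1 ++ w2) =
  map_walk f g u w1 ++ map_walk f g (last u (map snd w1)) w2.
Proof. by elim: w1 u => [|[s v] w1 IH] u //=; rewrite IH. Qed.

Lemma walk_defect_cat u w1 w2 :
  walk_defect u (w1 ++ w2) =
  walk_defect u w1 (+) walk_defect (last u (map snd w1)) w2.
Proof. by rewrite /walk_defect map_walk_cat !walk_sign_cat addbACA. Qed.

Lemma walk_defect1 u s v : walk_defect u [:: (s, v)] = g s u v (+) s.
Proof. by rewrite /walk_defect !walk_sign_cons /walk_sign !big_nil !addbF. Qed.

Hypothesis g_sym : forall s u v, sedge G s u v -> g s u v = g s v u.

Lemma reverse_walk u w : is_walk G u w ->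
  exists w', [/\ is_walk G (last u (map snd w)) w',
    last (last u (map snd w)) (map snd w') = u &
    walk_defect (last u (map snd w)) w' = walk_defect u w].
Proof.
elim: w u => [|[s v] w IH] u /=; first by exists [::].
move=> /andP[uv /IH[w' [w'P w'l w'd]]]; exists (w' ++ [:: (s, u)]); split.
- by rewrite is_walk_cat w'P w'l /= sedge_sym uv.
- by rewrite map_cat last_cat.
- rewrite walk_defect_cat w'd w'l walk_defect1 -(g_sym _ _ _ uv) addbC.
  by rewrite -[(s, v) :: w]cat1s walk_defect_cat walk_defect1.
Qed.

End WalkDefect.

(** Choosing a witness for the predicate [r^~ x] gives the same point for related
    [x], because the predicates are then equal. *)
Lemma representatives (T : Type) (r : T -> T -> Prop) :
  (forall x, r x x) -> (forall x y, r x y -> r y x) ->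
  (forall x y z, r x y -> r y z -> r x z) ->
  exists rep : T -> T,
    (forall x, r (rep x) x) /\ (forall x y, r x y -> rep x = rep y).
Proof.
move=> rr rs rt.
have ex x : exists y, r y x by exists x.
exists (fun x => sval (cid (ex x))); split=> [x|x y xy].
  exact: svalP (cid (ex x)).
have E : (fun z => r z x) = (fun z => r z y).
  by apply/funext => z; apply/propext; split=> zx; apply: rt zx _ => //; exact: rs.
have cidE (P Q : T -> Prop) (p : exists z, P z) (q : exists z, Q z) :
    P = Q -> sval (cid p) = sval (cid q).
  by move=> PQ; subst Q; rewrite (Prop_irrelevance p q).
exact: cidE.
Qed.

(** In each component fix a root; a vertex is switched when the walks from the
    root to it have defect [true].  All these walks have the same defect, for two
    of them make a closed walk once one is reversed. *)
Lemma switching_homP : switching_hom G H <->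
  exists (f : V -> W) (t : V -> bool), forall s u v, sedge G s u v ->
    sedge H (s (+) (t u (+) t v)) (f u) (f v).
Proof.
split=> [[f [g [gs gH gc]]]|[f [t tH]]]; last first.
  exists f, (fun s u v => s (+) (t u (+) t v)); split=> [s u v _|//|u w [uw]].
    by rewrite [t u (+) _]addbC.
  suff -> : walk_sign (map_walk f (fun s u v => s (+) (t u (+) t v)) u w) =
      walk_sign w (+) (t u (+) t (last u (map snd w))).
    by move=> ->; rewrite addbb addbF.
  elim: w u {uw} => [|[s v] w IH] u /=.
    by rewrite /walk_sign !big_nil addbb.
  rewrite !walk_sign_cons /= IH; move: s (walk_sign w) (t u) (t v) (t (last v _)).
  by do 5 case.
pose conn u v := exists2 w, is_walk G u w & last u (map snd w) = v.
have conn_sym u v : conn u v -> conn v u.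
  by move=> [w uw <-]; have [w' [? ? _]] := reverse_walk f _ gs _ _ uw; exists w'.
have [|||rep [repP repE]] := @representatives V conn.
- by move=> u; exists [::].
- by [].
- move=> u v z [w1 uv v1] [w2 vz z2]; exists (w1 ++ w2).
    by rewrite is_walk_cat uv v1.
  by rewrite map_cat last_cat v1.
pose path v := s2val (cid2 (repP v)).
have pathP v : is_walk G (rep v) (path v) by exact: s2valP (cid2 (repP v)).
have pathl v : last (rep v) (map snd (path v)) = v.
  exact: s2valP' (cid2 (repP v)).
exists f, (fun v => walk_defect f g (rep v) (path v)) => s u v uv.
have ruv : rep u = rep v by apply: repE; exists [:: (s, v)]; rewrite //= uv.
have [w' []] := reverse_walk f _ gs _ _ (pathP v).
rewrite pathl => vw' lw' dw'.
have := gc (rep u) (path u ++ (s, v) :: w').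
have cl : is_closed_walk G (rep u) (path u ++ (s, v) :: w').
  split; first by rewrite is_walk_cat pathP pathl /= uv.
  by rewrite map_cat last_cat /= lw'.
move=> /(_ cl) /eqP; rewrite -negb_add -/(walk_defect f g _ _).
rewrite walk_defect_cat -[(s, v) :: w']cat1s walk_defect_cat walk_defect1 /= pathl dw'.
have gE (b c x y : bool) : ~~ (x (+) (b (+) c (+) y)) -> b = c (+) (x (+) y).
  by case: b c x y => [] [] [] [].
by move=> /gE <-; exact: gH.
Qed.

End SwitchingHom.

(** * Colorings on the universal cover of the circle *)

(** The half period [h] is the parameter, rather than the period, so that one
    formula covers both signs: the even multiples of [h] are the lifts of 0 and the
    odd ones the lifts of its antipode. *)
Definition apart {R : numDomainType} (h q : R) (s : sign) (d : R) : Prop :=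
  forall k : int, odd `|k|%N = s -> q <= `|d + k%:~R * h|.

Section Apart.
Variable R : numDomainType.
Implicit Types h q d : R.

(** Moving one end to its antipode, an odd number of half periods away, flips the
    sign of the edge; even translations are full turns. *)
Lemma apart_shift h q s d (j : int) :
  apart h q s (d + j%:~R * h) <-> apart h q (s (+) odd `|j|%N) d.
Proof.
split=> A k ks.
  rewrite (_ : d + _ = d + j%:~R * h + (k - j)%:~R * h); last first.
    by rewrite rmorphB /=; ring.
  by apply: A; move: ks; case: s => /=; lia.
rewrite -addrA -mulrDl -rmorphD /=.
by apply: A; move: ks; case: s => /=; lia.
Qed.

Lemma apart_scale h q s d c : 0 < c ->
  apart h q s d -> apart (c * h) (c * q) s (c * d).
Proof.
move=> c0 A k ks; rewrite mulrCA -mulrDr normrM gtr0_norm // ler_pM2l //.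
exact: A.
Qed.

Lemma apart_weaken h q q' s d : q' <= q -> apart h q s d -> apart h q' s d.
Proof. by move=> q'q A k ks; apply: le_trans q'q _; exact: A. Qed.

Lemma apart_intr (h q d : int) s :
  apart (h%:~R : R) q%:~R s d%:~R <-> apart h q s d.
Proof.
by split=> A k /A; rewrite -intrM -intrD -intr_norm ler_int intz.
Qed.

End Apart.

Section Circle.
Variable R : realType.

(** For two points of [0, r) only the three lifts of their difference by -r, 0 and
    r matter, since the others are farther from 0. *)
Lemma circle_dist_apart (r x y : R) : 0 <= x < r -> 0 <= y < r ->
  1 <= circle_dist r x y <-> apart (r / 2) 1 positive (x - y).
Proof.
move=> xr yr; rewrite /circle_dist le_min; split=> [/andP[d1 d2] k ks|A].
  have [j ->] : exists j : int, k = j * 2.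
    by exists (k %/ 2)%Z; rewrite /positive in ks; lia.
  rewrite (_ : _ * (r / 2) = j%:~R * r); last by rewrite intrM; lra.
  have [j0|[j0|->]] : j <= -1 \/ 1 <= j \/ j = 0 by lia.
  - have : (j + 1)%:~R * r <= 0.
      by apply: mulr_le0_ge0; [rewrite lerz0; lia|lra].
    rewrite intrD mulrDl mul1r ler_normr => jr; apply/orP; right.
    by move: d1 d2; case: (ger0P (x - y)) => ? ? ?; lra.
  - have : 0 <= (j - 1)%:~R * r.
      by apply: mulr_ge0; [rewrite ler0z; lia|lra].
    rewrite intrB mulrBl mul1r ler_normr => jr; apply/orP; left.
    by move: d1 d2; case: (ger0P (x - y)) => ? ? ?; lra.
  - by rewrite mul0r addr0.
have := A 0 erefl; have := A 2 erefl; have := A (- 2) erefl.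
rewrite mul0r addr0 rmorphN /=.
rewrite (_ : 2%:~R * (r / 2) = r); last lra.
rewrite (_ : - 2%:~R * (r / 2) = - r); last lra.
move=> A1 A2 A3; rewrite A3 /=; move: A1 A2; rewrite !ler_normr.
by case: (ger0P (x - y)) => ? /orP[] ? /orP[] ?; lra.
Qed.

Lemma circle_antipode (r x : R) : 0 <= x < r -> 0 <= antipode r x < r.
Proof. by move=> xr; rewrite /antipode; case: ltP => ?; lra. Qed.

Lemma circle_dist_antipode_apart (r x y : R) : 0 <= x < r -> 0 <= y < r ->
  1 <= circle_dist r x (antipode r y) <-> apart (r / 2) 1 negative (x - y).
Proof.
move=> xr yr; rewrite circle_dist_apart ?circle_antipode // /antipode.
case: ltP => _.
  rewrite (_ : x - _ = x - y + (-1)%:~R * (r / 2)); first exact: apart_shift.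
  by rewrite rmorphN; ring.
rewrite (_ : x - _ = x - y + 1%:~R * (r / 2)); first exact: apart_shift.
by ring.
Qed.

Lemma circular_coloringP (V : Type) (G : sgraph V) (r : R) (phi : V -> R) :
  circular_coloring G r phi <->
  (forall v, 0 <= phi v < r) /\
  forall s u v, sedge G s u v -> apart (r / 2) 1 s (phi u - phi v).
Proof.
split=> [[c P N]|[c A]].
  split=> // -[] u v uv.
    exact: (circle_dist_antipode_apart _ _ _ (c u) (c v)).1 (N _ _ uv).
  exact: (circle_dist_apart _ _ _ (c u) (c v)).1 (P _ _ uv).
split=> [//|u v uv|u v uv].
  exact: (circle_dist_apart _ _ _ (c u) (c v)).2 (A _ _ _ uv).
exact: (circle_dist_antipode_apart _ _ _ (c u) (c v)).2 (A _ _ _ uv).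
Qed.

End Circle.

(** * The circular chromatic number is attained *)

Section Attained.
Variable R : realType.

Local Open Scope classical_set_scope.

Lemma ultra_cvg_bounded (F : set_system nat) (u : nat -> R) (a b : R) :
  UltraFilter F -> (forall n, a <= u n <= b) -> exists l : R, u n @[n --> F] --> l.
Proof.
move=> FU uab.
have FP : ProperFilter F := @ultra_proper _ _ FU.
have uU : UltraFilter (u n @[n --> F]).
  split=> [|G GP FG]; first exact: fmap_proper_filter.
  apply/seteqP; split=> // A GA.
  have [//|FA] := in_ultra_setVsetC (u @^-1` A) FU.
  have GA' : G (~` A) by exact: FG.
  by have := filter_ex (filterI GA GA') => -[? []].
have := @segment_compact R a b; rewrite compact_ultra.
have Fab : F (u @^-1` `[a, b]).
  by apply: filterS (@filterT _ F _) => n _; rewrite /= in_itv /=.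
by move=> /(_ _ uU Fab) [l [_ ul]]; exists l.
Qed.

(** Take colorings on circles of circumference at most [r0 + 1 / (n + 1)].  Along an
    ultrafilter refining [\oo] the circumferences converge, and so do the colors of
    every vertex simultaneously, whatever the cardinality of the graph; the edge
    constraints are closed conditions.  A limit color may be the right end [r], which
    is why the conclusion does not ask for points of [0, r). *)
Lemma circular_chromatic_number_attained (V : Type) (G : sgraph V) (r0 : R) :
  (circular_chromatic_number R G <= r0%:E)%E ->
  exists (r : R) (phi : V -> R), 1 <= r <= r0 /\
    forall s u v, sedge G s u v -> apart (r / 2) 1 s (phi u - phi v).
Proof.
move=> chi_r0.
have approx (n : nat) : exists rphi : R * (V -> R),
    [/\ 1 <= rphi.1, rphi.1 <= r0 + n.+1%:R^-1 &
        circular_coloring G rphi.1 rphi.2].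
  have : (circular_chromatic_number R G < (r0 + n.+1%:R^-1)%:E)%E.
    by apply: le_lt_trans chi_r0 _; rewrite lte_fin ltrDl invr_gt0.
  move=> /ereal_inf_lt[_ [r [r1 [phi rphi]] <-]]; rewrite lte_fin => rr0.
  by exists (r, phi); split=> //=; exact: ltW.
have [rphi rphiP] := choice approx.
pose r n := (rphi n).1; pose phi n := (rphi n).2.
have [U [UU infU]] := ultraFilterLemma eventually_filter.
have UP : ProperFilter U := @ultra_proper _ _ UU.
have r_le n : r n <= r0 + 1.
  have [_ rn _] := rphiP n; apply: le_trans rn _.
  by rewrite lerD2l invf_le1 // ler1n.
have [rho r_rho] : exists l : R, r n @[n --> U] --> l.
  apply: (ultra_cvg_bounded _ _ 1 (r0 + 1)) => // n.
  by have [r1 _ _] := rphiP n; rewrite r1 /=.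
have phi_cvg v : exists l : R, phi n v @[n --> U] --> l.
  apply: (ultra_cvg_bounded _ _ 0 (r0 + 1)) => // n.
  have [_ _ /circular_coloringP[/(_ v)/andP[v0 vr] _]] := rphiP n.
  by rewrite v0 /=; exact: le_trans (ltW vr) (r_le n).
have [psi psiP] := choice phi_cvg.
have everywhere (P : nat -> Prop) : (forall n, P n) -> \forall n \near U, P n.
  by move=> Pn; apply: filterS (@filterT _ U _) => n _; exact: Pn.
exists rho, psi; split.
  apply/andP; split.
    by apply: (cvgr_to_ge r_rho); apply: everywhere => n; have [] := rphiP n.
  have inv_cvg : n.+1%:R^-1 @[n --> U] --> (0 : R).
    by move=> A A0; apply: infU; exact: (@cvg_harmonic R).
  rewrite -[rho]subr0; apply: (cvgr_to_le (cvgB r_rho inv_cvg)).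
  by apply: everywhere => n; have [_ + _] := rphiP n; rewrite -lerBlDr.
move=> s u v uv k ks.
have lim_uv : `|phi n u - phi n v + k%:~R * (r n / 2)| @[n --> U] -->
    `|psi u - psi v + k%:~R * (rho / 2)|.
  apply: cvg_norm; apply: cvgD; first by apply: cvgB; exact: psiP.
  by apply: cvgMl_tmp; apply: cvgMr_tmp; exact: r_rho.
apply: (cvgr_to_ge lim_uv); apply: everywhere => n.
have [_ _ /circular_coloringP[_ A]] := rphiP n.
exact: A uv k ks.
Qed.

End Attained.
(** * Rounding to integers of prescribed parity *)

Section Rounding.
Variable R : realType.

(** Each inequality of [apart] compares [y] with a translate of [x] by an integer
    [k * h - q] or [k * h + q], so a monotone rounding of [y] preserves it as soon as it
    turns these translates into translates of the rounding of [x].  The hypothesis on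
    [z] singles out the parity that these integers share. *)
Lemma apart_round (h q : int) s (f g : R -> int) (x y : R) :
  {homo g : a b / a <= b} ->
  (forall z : int, odd `|z|%N = (s && odd `|h|%N) (+) odd `|q|%N ->
    g (x + z%:~R) = f x + z) ->
  apart (h%:~R : R) q%:~R s (x - y) -> apart h q s (f x - g y).
Proof.
move=> g_mono gf A k ks; rewrite intz.
have par (z : int) : (z = k * h - q \/ z = k * h + q) ->
    odd `|z|%N = (s && odd `|h|%N) (+) odd `|q|%N.
  rewrite -ks -oddM -abszM; move: (k * h) => kh.
  by case=> ->; lia.
have := A k ks; rewrite !ler_normr => /orP[] xy; apply/orP; [left|right].
- have : y <= x + (k * h - q)%:~R by rewrite intrB intrM; lra.
  by move/g_mono; rewrite gf; [lia|apply: par; left].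
- have : x + (k * h + q)%:~R <= y by rewrite intrD intrM; lra.
  by move/g_mono; rewrite gf; [lia|apply: par; right].
Qed.

(** The greatest integer of parity [b] that is at most [x]. *)
Definition parity_floor (b : bool) (x : R) : int :=
  2 * Num.floor ((x - b%:R) / 2) + b%:R.

Lemma parity_floor_mono b : {homo parity_floor b : x y / x <= y}.
Proof.
move=> x y xy; rewrite lerD2r ler_pM2l //; apply: le_floor.
by rewrite ler_pM2r ?invr_gt0 // lerD2r.
Qed.

Lemma odd_parity_floor b x : odd `|parity_floor b x|%N = b.
Proof. by rewrite /parity_floor; case: b; move: (Num.floor _) => n /=; lia. Qed.

Lemma parity_floorD b x (z : int) : odd `|z|%N ->
  parity_floor (~~ b) (x + z%:~R) = parity_floor b x + z.
Proof.
move=> oz; rewrite /parity_floor.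
(* [z] is odd and so is [~~ b - b]; hence the shift of the floor is by an integer. *)
have [j zE] : exists j : int, z = 2 * j + (~~ b)%:R - b%:R.
  by exists ((z - (~~ b)%:R + b%:R) %/ 2)%Z; case: b => /=; lia.
rewrite (_ : (x + _ - _) / 2 = (x - b%:R) / 2 + j%:~R).
  rewrite floorDrz ?intr_int // intrKfloor zE.
  by move: (Num.floor _); case: (b) => n /=; lia.
rewrite zE; case: (b) => /=; rewrite ?intrB ?intrD intrM; lra.
Qed.

(** Two ways to reach the parity [side v].  If [h] is odd, an integer part of the
    wrong parity is corrected by a translation by [h], recorded in [t].  If [h] is even,
    antipodes have equal parities and switching cannot help, but [q] is odd and the
    two parity floors are compatible with the constraint. *)
Lemma parity_rounding (V : Type) (G : sgraph V) (h q : nat) (X : V -> R)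
    (side : V -> bool) :
  odd h || odd q ->
  (forall s u v, sedge G s u v -> side u != side v) ->
  (forall s u v, sedge G s u v -> apart (h%:R : R) q%:R s (X u - X v)) ->
  exists (c : V -> int) (t : V -> bool),
    (forall v, odd `|c v|%N = side v) /\
    forall s u v, sedge G s u v ->
      apart (h : int) q (s (+) (t u (+) t v)) (c u - c v).
Proof.
move=> hq bip A; have [oh|eh] := boolP (odd h); last first.
  have oq : odd q by move: hq; rewrite (negbTE eh).
  exists (fun v => parity_floor (side v) (X v)), (fun=> false); split=> [v|s u v uv].
    exact: odd_parity_floor.
  rewrite /= addbF; apply: (apart_round h q s _ _ (X u) (X v)) => [|z|].
  - exact: parity_floor_mono.
  - rewrite ?absz_nat (negbTE eh) oq andbF addFb => oz.
    have -> : side v = ~~ side u by case: (side u) (side v) (bip _ _ _ uv) => -[].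
    exact: parity_floorD.
  - exact: A.
pose t v := odd `|Num.floor (X v)|%N != side v.
exists (fun v => Num.floor (X v) + (t v)%:Z * h), t; split=> [v|s u v uv].
  rewrite /t; move: (Num.floor _) => n.
  by case: (side v); case: (boolP (odd `|n|%N)) => on /=; lia.
have F : apart (h : int) q s (Num.floor (X u) - Num.floor (X v)).
  apply: (apart_round h q s _ _ (X u) (X v)) => [|z _|]; [exact: le_floor| |exact: A].
  by rewrite floorDrz ?intr_int // intrKfloor.
rewrite (_ : _ + _ - _ = Num.floor (X u) - Num.floor (X v) +
  ((t u)%:Z - (t v)%:Z)%:~R * (h : int)); last by rewrite intz; ring.
apply/apart_shift; suff -> : s (+) (t u (+) t v) (+)
  odd `|((t u)%:Z - (t v)%:Z)|%N = s by [].
by case: s (t u) (t v) {F uv} => [] [] [].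
Qed.

End Rounding.

(** * The target graph *)

Section Target.
Variables p q : nat.
Hypothesis p_even : ~~ odd p.

(** For vertices less than [p] apart, the multiples [k * (p/2)] with [`|k| <= 2] give
    the two bounds of the definition of an edge.  The farther ones are implied, as
    the existence of an edge between distinct vertices forces [q <= p/2]. *)
Lemma Bpq_edgeP s (i j : 'I_p) : Bpq_edge q s i j <->
  odd i != odd j /\ apart (p./2 : int) q s ((i : nat)%:Z - (j : nat)%:Z).
Proof.
have [ip jp] := (ltn_ord i, ltn_ord j).
have pE : p = (p./2 + p./2)%N by rewrite addnn even_halfK.
move: (p./2) pE => h pE; rewrite /Bpq_edge; split=> [/andP[oij B]|[oij A]].
  split=> // k ks; rewrite intz.
  have kh_ge (m : int) : m <= k -> m * h%:Z <= k * h.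
    by move=> ?; apply: ler_wpM2r.
  have kh_le (m : int) : k <= m -> k * h <= m * h%:Z.
    by move=> ?; apply: ler_wpM2r.
  case: s ks B => /= ks B.
    have : k <= -3 \/ k = -1 \/ k = 1 \/ 3 <= k by lia.
    by case=> [/kh_le|[->|[->|/kh_ge]]]; first [lia | move: (k * h) => kh; lia].
  have : k <= -2 \/ k = 0 \/ 2 <= k by lia.
  by case=> [/kh_le|[->|/kh_ge]]; first [lia | move: (k * h) => kh; lia].
rewrite oij /=.
case: s A => A.
  by have := A 1 erefl; have := A (- 1) erefl; rewrite /= !intz; lia.
by have := A 0 erefl; have := A 2 erefl; have := A (- 2) erefl; rewrite /= !intz; lia.
Qed.

End Target.
(** If [p/2] and [q] were both even, dividing [p] and [q] by 2 would give a smaller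
    even numerator. *)
Lemma even_simplest_form_parity (p q : nat) :
  even_simplest_form p q -> odd p./2 || odd q.
Proof.
move=> [p0 q0 p_even min]; apply/negPn/negP; rewrite negb_or => /andP[hE qE].
have pE : p = (p./2 * 2)%N by rewrite muln2 even_halfK.
have qE2 : q = (q./2 * 2)%N by rewrite muln2 even_halfK.
have : (p <= p./2)%N.
  apply: (min _ q./2) => //; [lia|lia|].
  rewrite {2}pE {2}qE2 !natrM -mulf_div divff ?mulr1 //.
by lia.
Qed.

(** * Colorings and homomorphisms *)

Section ColoringsAndHomomorphisms.
Variables (R : realType) (V : Type) (G : sgraph V) (p q : nat).
Hypotheses (p0 : (0 < p)%N) (q0 : (0 < q)%N) (p_even : ~~ odd p).

Lemma half_natr : (p%:R / 2 : R) = p./2%:R.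
Proof.
rewrite -{1}(even_halfK p_even) -muln2 natrM mulfK //.
Qed.

(** Reduction modulo [p] moves by an even number of half periods, hence keeps the
    sign of the constraints; as [p] is even it keeps the parity too. *)
Lemma modz_half (c : int) : (c %% p)%Z = c - 2 * (c %/ p)%Z * p./2.
Proof.
have pE : p%:Z = 2 * p./2%:Z by lia.
by rewrite /modz {2}pE; ring.
Qed.

Lemma modz_itv (c : int) : 0 <= (c %% p)%Z < p.
Proof. by rewrite modz_ge0 ?ltz_pmod //; lia. Qed.

Lemma coloring_hom : odd p./2 || odd q -> sbipartite G ->
  (circular_chromatic_number R G <= (p%:R / q%:R)%:E)%E ->
  switching_hom G (Bpq p q).
Proof.
move=> hq [side bip] /circular_chromatic_number_attained[r [phi [/andP[r1 rpq] A]]].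
have r_gt0 : 0 < r by lra.
have q_gt0 : 0 < q%:R :> R by rewrite ltr0n.
pose X v := p%:R / r * phi v.
have XA s u v : sedge G s u v -> apart (p./2%:R : R) q%:R s (X u - X v).
  move=> /A /(@apart_scale _ _ _ _ _ (p%:R / r)).
  rewrite divr_gt0 ?ltr0n // -mulrBr mulr1 => /(_ isT).
  rewrite mulrA mulfVK ?gt_eqF // half_natr.
  by apply: apart_weaken; rewrite ler_pdivlMr // mulrC -ler_pdivlMr.
have [c [t [c_side cA]]] := parity_rounding _ _ _ _ _ X _ hq bip XA.
have fP v : (`|(c v %% p)%Z| < p)%N by have := modz_itv (c v); lia.
apply/switching_homP; exists (fun v => Ordinal (fP v)), t => s u v uv.
apply/Bpq_edgeP => //; split=> /=.
  have par w : odd `|(c w %% p)%Z|%N = side w.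
    by rewrite -c_side modz_half -mulrA; move: (_ * (p./2 : int)) => m; lia.
  by rewrite !par; exact: bip uv.
pose j : int := (- 2 * ((c u %/ p)%Z - (c v %/ p)%Z)).
have -> : `|(c u %% p)%Z|%N%:Z - `|(c v %% p)%Z|%N%:Z =
    c u - c v + j%:~R * (p./2 : int).
  have abs_mod w : `|(c w %% p)%Z|%N%:Z = (c w %% p)%Z.
    by have := modz_itv (c w); lia.
  by rewrite !abs_mod !modz_half intz /j; ring.
apply/apart_shift; have -> : odd `|j|%N = false by rewrite /j; lia.
by rewrite addbF; exact: cA.
Qed.

Lemma hom_coloring : 1 <= (p%:R / q%:R : R) -> switching_hom G (Bpq p q) ->
  (circular_chromatic_number R G <= (p%:R / q%:R)%:E)%E.
Proof.
move=> pq1 /switching_homP[f [t ft]].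
have q_gt0 : 0 < q%:R :> R by rewrite ltr0n.
pose c v : int := ((f v : nat)%:Z + (t v)%:Z * p./2)%Z.
apply: ereal_inf_lbound; exists (p%:R / q%:R) => //; split=> //.
exists (fun v => (c v %% p)%Z%:~R / q%:R); apply/circular_coloringP; split=> [v|s u v uv].
  have /andP[m0 mp] := modz_itv (c v).
  by rewrite divr_ge0 ?ler0z //= ltr_pM2r ?invr_gt0 // -[p%:R]/(p%:Z%:~R) ltr_int.
have {ft}/(Bpq_edgeP _ _ p_even)[_ A] := ft _ _ _ uv.
(* [J w] counts half periods: one if [w] is switched, minus the full turns removed. *)
pose J w : int := ((t w)%:Z - 2 * (c w %/ p)%Z).
have cJ w : (c w %% p)%Z = (f w : nat)%:Z + J w * p./2.
  by rewrite modz_half /J {1}/c; ring.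
have JA : apart (p./2 : int) q s ((c u %% p)%Z - (c v %% p)%Z).
  rewrite (_ : _ - _ = (f u : nat)%:Z - (f v : nat)%:Z + (J u - J v)%:~R * (p./2 : int)).
    apply/apart_shift; suff -> : odd `|J u - J v|%N = t u (+) t v by [].
    by rewrite /J; case: (t u) (t v) => [] []; lia.
  by rewrite !cJ intz; ring.
rewrite (_ : p%:R / q%:R / 2 = q%:R^-1 * p./2%:R); last first.
  by rewrite -half_natr; ring.
rewrite -mulrBl -rmorphB /= [_%:~R / q%:R]mulrC.
rewrite -[X in apart _ X](mulVf (lt0r_neq0 q_gt0)).
apply: (apart_scale R p./2%:R q%:R s _ q%:R^-1); first by rewrite invr_gt0.
exact: (apart_intr R p./2 q _ s).2 JA.
Qed.

End ColoringsAndHomomorphisms.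

Theorem theorem2p4 (R : realType) (V : Type) (G : sgraph V) (p q : nat)
    (hG : sbipartite G)
    (hpq : even_simplest_form p q)
    (hr : 2 <= (p%:R / q%:R : R) <= 4) :
  (circular_chromatic_number R G <= (p%:R / q%:R)%:E)%E
  <-> switching_hom G (Bpq p q).
Proof.
have [p0 q0 p_even _] := hpq; split.
  exact: coloring_hom (even_simplest_form_parity _ _ hpq) hG.
by apply: hom_coloring => //; lra.
Qed.
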